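(* Let $G$ be a finite group, let $x\in G$, and let $\chi$ be a character of $G$. Then $$C_\chi(x)=\begin{cases}|[x^G]| & \text{if }K=\langle x^G\rangle,\\[4pt] \displaystyle\sum_{\substack{E\subseteq\mathcal M_G(\langle x^G\rangle)\\ \bigcap_{M\in E}M\subseteq K}}\Big|\bigcap_{M\in E}M\Big|\,(-1)^{|E|} & \text{if }K=\bigcap_{M\in E}M\text{ for some }E\subseteq\mathcal M_G(\langle x^G\rangle),\\[4pt] 0&\text{otherwise,}\end{cases}$$ where $K=\mathrm{Ker}(\chi)\cap\langle x^G\rangle$.
   Context: Let $G$ be a finite group with identity $\mathbf 1$. A character $\chi$ of $G$ is the function $\chi(g)=\mathrm{Tr}(\rho(g))$ associated with a representation $\rho:G\to \mathrm{GL}_n(\mathbb C)$ of $G$. For $x\in G$, $x^G=\{gxg^{-1}:g\in G\}$, $\langle x^G\rangle$ is the normal subgroup of $G$ generated by $x^G$, and $[x^G]=\{y\in G:\langle y^G\rangle=\langle x^G\rangle\}$. For a character $\chi$ of $G$, $\mathrm{Ker}(\chi)=\{g\in G:\chi(g)=\chi(\mathbf 1)\}$ and $C_\chi(x)=\frac{1}{\chi(\mathbf 1)}\sum_{s\in[x^G]}\chi(s)$. For a normal subgroup $U$ of $G$, $\mathcal M_G(U)$ denotes the set of all maximal $G$-normal subgroups of $U$: normal subgroups of $G$ that are properly contained in $U$ and are maximal under inclusion among such subgroups. The intersection of the empty subfamily of $\mathcal M_G(U)$ is taken to be $U$.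
   Formalization: The character χ is taken to be irreducible; for arbitrary characters the formula fails (for G of prime order, x ≠ 1 and χ the regular character, C_χ(x) = 0 but the sum in the second case is −1). *)

(* Defs.v *)
From mathcomp Require Import all_boot all_order all_fingroup all_algebra.
From mathcomp Require Import all_solvable all_field all_character.

Set Implicit Arguments.
Unset Strict Implicit.
Unset Printing Implicit Defensive.

Import GroupScope GRing.Theory.

Definition nclosure (gT : finGroupType) (G : {group gT}) (x : gT) : {set gT} :=
  <<x ^: G>>.

Definition nclosure_eqclass (gT : finGroupType) (G : {group gT}) (x : gT)
    : {set gT} :=
  [set y in G | nclosure G y == nclosure G x].

(* For a character chi this is cfker chi, by cfkerEchar. *)
Definition char_ker (gT : finGroupType) (G : {group gT}) (chi : 'CF(G))
    : {set gT} :=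
  [set g in G | chi g == chi 1].

Definition char_sum (gT : finGroupType) (G : {group gT}) (chi : 'CF(G))
    (x : gT) : algC :=
  ((chi 1%g)^-1 * \sum_(s in nclosure_eqclass G x) chi s)%R.

(* When U \subset G, maxnormal M U G says that M is maximal for inclusion
   among the proper subgroups of U that are normal in G. *)
Definition max_normals (gT : finGroupType) (G : {group gT}) (U : {set gT})
    : {set {group gT}} :=
  [set M : {group gT} | maxnormal M U G].

(* The empty \bigcap is the full set setT; intersecting with U makes it U, and
   changes nothing for a nonempty family E of subgroups of U. *)
Definition cap_in (gT : finGroupType) (U : {set gT}) (E : {set {group gT}})
    : {set gT} :=
  U :&: \bigcap_(M in E) M.

(* Main.v *)
(** For [N] normal in [G] and [chi] irreducible, the sum of [chi] over [N] is
    [#|N| * chi 1] if [N] lies in the kernel of [chi], and [0] otherwise.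
    Since [[x^G]] is [U] with all the maximal [G]-normal subgroups of [U]
    removed, inclusion-exclusion gives the alternating sum of the second case
    for every [chi]. That sum is empty unless the intersection of all the
    maximal [G]-normal subgroups of [U] lies in [K], and then [K] is itself an
    intersection of such subgroups. *)
Require Import Defs.
From mathcomp Require Import all_boot all_order all_fingroup all_algebra.
From mathcomp Require Import all_solvable all_field all_character.

Set Implicit Arguments.
Unset Strict Implicit.
Unset Printing Implicit Defensive.

Import GroupScope GRing.Theory.

(** Expand the product over all [i : T] of [-1 + 1] for [i \in A] and [0 + 1] otherwise: a single
    [i] in [A] makes it vanish. *)
Lemma sum_sign_subsets (R : comPzRingType) (T : finType) (A : {set T}) :
  (\sum_(E : {set T} | E \subset A) (-1) ^+ #|E| = (A == set0)%:R :> R)%R.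
Proof.
transitivity (\prod_(i : T) ((if i \in A then -1 else 0) + 1) : R)%R.
  rewrite bigA_distr [RHS](bigID (fun E : {set T} => E \subset A)) /=.
  rewrite [X in (_ + X)%R]big1 ?addr0 => [|E /= /subsetPn[i Ei /negPf nAi]].
    apply: eq_bigr => E sEA; rewrite -prodr_const big_mkcond /=.
    by apply: eq_bigr => i _; case: ifP => // /(subsetP sEA) ->.
  by rewrite (bigD1 i) //= Ei nAi mul0r.
have [->|[i Ai]] := set_0Vmem A.
  by rewrite eqxx big1 // => i _; rewrite inE add0r.
rewrite (bigD1 i) //= Ai addNr mul0r.
by case: eqP Ai => // ->; rewrite inE.
Qed.

Section NormalSubgroups.

Variables (gT : finGroupType) (G : {group gT}).
Implicit Types (U K M N : {group gT}).

Lemma maxnormal_exists U N :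
  N \proper U -> G \subset 'N(N) ->
  exists2 M : {group gT}, maxnormal M U G & N \subset M.
Proof.
move=> prN nNG.
pose P := [pred H : {group gT} | (H \proper U) && (G \subset 'N(H))].
have PN : P N by rewrite /= prN.
by have [M maxM sNM] := maxgroup_exists PN; exists M.
Qed.

(** [N <*> M] is [G]-normal and lies between [M] and [U]; were it proper in [U], maximality would
    make it [M]. *)
Lemma maxnormalM U M N :
    maxnormal M U G -> N \subset U -> N \subset G -> G \subset 'N(N) ->
  ~~ (N \subset M) -> N * M = U.
Proof.
move=> /maxgroupP[/andP[prM nMG] maxM] sNU sNG nNG /negP nsNM.
have nMN := subset_trans sNG nMG.
have NM : N <*> M = N * M by rewrite norm_joinEl.
apply/eqP/negPn/negP=> neq; apply: nsNM.
rewrite -(maxM [group of N <*> M]) ?joing_subl ?joing_subr //=.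
rewrite normsY // andbT properEneq join_subG sNU (proper_sub prM) NM.
by rewrite neq.
Qed.

(* With [D] minimal among the [G]-normal subgroups such that [K * D = U], and
   [L] the intersection of the maximal subgroups over [K], the modular law
   gives [L = K * (D :&: L)], and minimality of [D] puts [D :&: L] inside every
   maximal [G]-normal subgroup of [U]. *)
Lemma cap_max_normals_over U K :
    U <| G -> K \subset U -> G \subset 'N(K) ->
    cap_in U (max_normals G U) \subset K ->
  cap_in U [set M in max_normals G U | K \subset M] = K.
Proof.
move=> /andP[sUG nUG] sKU nKG sRK.
set E := [set M in _ | _]; set L := cap_in U E.
have sKL : K \subset L.
  by rewrite subsetI sKU; apply/bigcapsP=> M; rewrite inE => /andP[].
apply/eqP; rewrite eqEsubset sKL andbT.
pose P := [pred H : {group gT} |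
  [&& H \subset U, G \subset 'N(H) & U \subset K * H]].
have PU : P U by rewrite /= subxx nUG mulG_subr.
have [D /mingroupP[/and3P[sDU nDG sUKD] minD] _] := mingroup_exists PU.
have nLG : G \subset 'N(L).
  rewrite normsI //; apply: norms_bigcap; apply/bigcapsP=> M.
  by rewrite !inE => /andP[/maxgroupp/andP[_]].
have sLN M : maxnormal M U G -> K \subset M -> L \subset M.
  move=> maxM sKM; apply: subset_trans (subsetIr _ _) _.
  by apply: bigcap_inf; rewrite !inE maxM.
(* Suppose a maximal [M] misses part of [D :&: L]. Then [(D :&: L) * M = U], and intersecting with
   [D] splits [D] as [(D :&: L) * (M :&: D)]. *)
have sWR : D :&: L \subset cap_in U (max_normals G U).
  rewrite subsetI (subset_trans (subsetIl _ _)) //; apply/bigcapsP=> M.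
  rewrite inE => maxM; apply/negPn/negP=> nsWM.
  have /andP[_ nMG] := maxgroupp maxM.
  have sDLU : D :&: L \subset U by rewrite (subset_trans (subsetIl _ _)).
  have nDLG : G \subset 'N(D :&: L) by rewrite normsI.
  have defU := maxnormalM maxM sDLU (subset_trans sDLU sUG) nDLG nsWM.
  have defD : (D :&: L) * (M :&: D) = D.
    by rewrite group_modl ?subsetIl // defU; apply/setIidPr.
  have nMDG : G \subset 'N(M :&: D) by rewrite normsI.
  have sMDU : M :&: D \subset U by rewrite (subset_trans (subsetIr _ _)).
  (* Otherwise [M :&: D] satisfies [P], so it equals [D] by minimality, and [D :&: L] lies in [M]
     after all. *)
  have prKMD : K <*> (M :&: D) \proper U.
    rewrite properE join_subG sKU sMDU norm_joinEr; last first.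
      exact: subset_trans (subset_trans sMDU sUG) nKG.
    apply: contra nsWM => sUK.
    have <- := minD [group of M :&: D] _ (subsetIr _ _); last exact/and3P.
    by rewrite /= -setIA subsetIl.
  (* [N] contains [K], hence [L], hence both factors of [D]; so it contains [K * D], which is all of
     [U]. *)
  have [N maxN] := maxnormal_exists prKMD (normsY nKG nMDG).
  rewrite join_subG => /andP[sKN sMDN].
  have /andP[/andP[_ /negP nsUN] _] := maxgroupp maxN; apply: nsUN.
  apply: subset_trans sUKD _; rewrite mulG_subG sKN -defD mulG_subG sMDN.
  by rewrite (subset_trans (subsetIr _ _)) // sLN.
have -> : L = K * (D :&: L).
  rewrite group_modl //; apply/esym/setIidPr.
  exact: subset_trans (subsetIl _ _) sUKD.
by rewrite mulG_subG subxx (subset_trans sWR).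
Qed.

(** The sum is [#|N|] times the multiplicity of the trivial character in the restriction of [chi] to
    [N]. By Clifford theory, if that is nonzero then [N] acts trivially. *)
Lemma sum_irr_normal N (chi : 'CF(G)) :
    chi \in irr G -> N <| G ->
  (\sum_(y in N) chi y = (N \subset cfker chi)%:R * (#|N|%:R * chi 1%g))%R.
Proof.
move=> /irrP[i ->] nsNG; have sNG := normal_sub nsNG.
case sNK: (N \subset _).
  rewrite mul1r mulr_natl -sumr_const; apply: eq_bigr => y Ny.
  by rewrite cfker1 // (subsetP sNK).
rewrite mul0r; apply/eqP; apply: contraFT sNK => nz_sum.
apply: (constt0_Res_cfker nsNG); rewrite irr_consttE irr0 cfdotE.
rewrite mulf_neq0 ?invr_eq0 ?neq0CG //; apply: contra nz_sum => /eqP sum0.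
rewrite -[X in _ == X]sum0; apply/eqP/eq_bigr => y Ny.
by rewrite cfResE // cfun1E Ny rmorph1 mulr1.
Qed.

Lemma nclosure_normal x : x \in G -> nclosure G x <| G.
Proof.
move=> Gx; rewrite /normal norms_gen ?class_norm // andbT.
by rewrite gen_subG class_subG.
Qed.

Lemma cap_in_normal U (E : {set {group gT}}) :
  U <| G -> E \subset max_normals G U -> cap_in U E <| G.
Proof.
move=> /andP[sUG nUG] sE; rewrite /normal subIset ?sUG //= normsI //.
apply: norms_bigcap; apply/bigcapsP=> M /(subsetP sE).
by rewrite inE => /maxgroupp/andP[].
Qed.

(** If the normal closure of [y] is proper in that of [x], it lies in a maximal [G]-normal subgroup;
    conversely, such a subgroup containing [y] contains its closure. *)
Lemma mem_nclosure_eqclass x y :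
    x \in G -> (y \in nclosure_eqclass G x) =
  (y \in nclosure G x)
    && ([set M in max_normals G (nclosure G x) | y \in M] == set0).
Proof.
move=> Gx; have /andP[sUG nUG] := nclosure_normal Gx.
have mem_self z : z \in nclosure G z by rewrite mem_gen ?class_refl.
have sub_ncl (H : {group gT}) z :
    G \subset 'N(H) -> z \in H -> nclosure G z \subset H.
  by move=> nHG Hz; rewrite gen_subG class_sub_norm.
rewrite inE; apply/andP/andP=> [[Gy /eqP eqU] | [Uy /eqP max0]].
  split; first by rewrite -eqU.
  apply/eqP/setP=> M; rewrite !inE; apply/negP=> /andP[].
  move=> /maxgroupp/andP[/properP[_ [z Uz nMz]] nMG] My.
  by case/negP: nMz; rewrite (subsetP (sub_ncl M y nMG My)) // eqU.
have Gy := subsetP sUG y Uy; split=> //.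
have sU : nclosure G y \subset nclosure G x by apply: sub_ncl nUG Uy.
rewrite eqEsubset sU; apply/negPn/negP=> nsU.
have prU : nclosure G y \proper nclosure G x by rewrite properE sU.
have nyG : G \subset 'N(nclosure G y) by case/andP: (nclosure_normal Gy).
have [M maxM sM] := maxnormal_exists (U := [group of nclosure G x])
  (N := [group of nclosure G y]) prU nyG.
by move/setP/(_ M): max0; rewrite !inE maxM (subsetP sM).
Qed.

(** After exchanging the sums, [f y] has as coefficient the signed count of the subsets of the
    family of maximal subgroups containing [y], which is 0 unless that family is empty. *)
Lemma sum_nclosure_eqclass x (f : gT -> algC) : x \in G ->
  (\sum_(y in nclosure_eqclass G x) f y =
   \sum_(E : {set {group gT}} | E \subset max_normals G (nclosure G x))
     (-1) ^+ #|E| * \sum_(y in cap_in (nclosure G x) E) f y)%R.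
Proof.
move=> Gx; set U := nclosure G x; set A := max_normals G U.
under [RHS]eq_bigr do rewrite mulr_sumr.
rewrite (exchange_big_dep (mem U)) /= => [|E y _]; last by case/setIP.
rewrite (eq_bigl (fun y => (y \in U) && ([set M in A | y \in M] == set0))).
  rewrite big_mkcondr; apply: eq_bigr => y Uy.
  rewrite -mulr_suml.
  rewrite (eq_bigl (fun E : {set {group gT}} =>
                      E \subset [set M in A | y \in M])) /=.
    by rewrite sum_sign_subsets; case: ifP; rewrite ?mul1r ?mul0r.
  move=> E; rewrite inE Uy /=; apply/andP/subsetP=> [[sEA /bigcapP yE] M EM | sE].
    by rewrite inE (subsetP sEA) ?yE.
  split; first by apply/subsetP=> M /sE; rewrite inE => /andP[].
  by apply/bigcapP=> M /sE; rewrite inE => /andP[].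
by move=> y; apply: mem_nclosure_eqclass.
Qed.

Lemma char_sum_cap_in x (chi : 'CF(G)) : x \in G -> chi \in irr G ->
  let U := nclosure G x in
  (char_sum chi x =
   \sum_(E : {set {group gT}} |
          (E \subset max_normals G U) && (cap_in U E \subset char_ker chi :&: U))
      #|cap_in U E|%:R * (-1) ^+ #|E|)%R.
Proof.
move=> Gx irr_chi U; have nsUG := nclosure_normal Gx.
have Kchi : char_ker chi = cfker chi by rewrite cfkerEchar ?irrWchar.
have nz_chi1 : (chi 1%g != 0)%R by case/irrP: irr_chi => i ->; apply: irr1_neq0.
rewrite /char_sum (sum_nclosure_eqclass chi) // mulr_sumr [RHS]big_mkcondr /=.
apply: eq_bigr => E sE; rewrite subsetI subsetIl andbT Kchi.
have nsCG := cap_in_normal (U := [group of U]) nsUG sE.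
rewrite (sum_irr_normal (N := [group of cap_in U E]) irr_chi nsCG) /=.
case: ifP => _; last by rewrite mul0r !mulr0.
by rewrite mul1r mulrCA [(_ * chi 1%g)%R]mulrC mulKf // mulrC.
Qed.

End NormalSubgroups.

Theorem theorem4p3 (gT : finGroupType) (G : {group gT}) (x : gT)
    (Gx : x \in G) (chi : 'CF(G)) (irr_chi : chi \in irr G) :
  let U := nclosure G x in
  let K := char_ker chi :&: U in
  let is_cap := exists2 E : {set {group gT}},
    E \subset max_normals G U & K = cap_in U E in
  [/\ K = U -> char_sum chi x = (#|nclosure_eqclass G x|%:R)%R,
      is_cap ->
        char_sum chi x =
          (\sum_(E : {set {group gT}} |
                 (E \subset max_normals G U) && (cap_in U E \subset K))
             #|cap_in U E|%:R * (-1) ^+ #|E|)%R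
    & ~ (K = U \/ is_cap) -> char_sum chi x = 0%R].
Proof.
move=> U K is_cap; have nsUG := nclosure_normal Gx.
have Kchi : char_ker chi = cfker chi by rewrite cfkerEchar ?irrWchar.
have nz_chi1 : (chi 1%g != 0)%R by case/irrP: irr_chi => i ->; apply: irr1_neq0.
split=> [defK | _ | not_cap]; last 2 first.
- exact: char_sum_cap_in.
- rewrite char_sum_cap_in // big1 // => E /andP[sE sCK]; case: not_cap; right.
  exists [set M in max_normals G U | K \subset M].
    by apply/subsetP=> M; rewrite inE => /andP[].
  have KE : K = cfker chi :&: U by rewrite /K Kchi.
  have nKG : G \subset 'N(cfker chi :&: U).
    by rewrite normsI ?cfker_norm // normal_norm.
  rewrite KE; apply/esym.
  apply: (cap_max_normals_over (U := [group of U])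
            (K := [group of cfker chi :&: U])) => //=.
    exact: subsetIr.
  (* Intersecting all maximal subgroups gives less than intersecting those in [E], so it still lands
     in [K]. *)
  rewrite -KE; apply: subset_trans sCK; apply: setIS.
  by apply/bigcapsP=> M EM; apply: bigcap_inf; apply: (subsetP sE).
(* When [K = U], [chi] is constantly [chi 1] on [U], which contains the class. *)
rewrite /char_sum (eq_bigr (fun=> chi 1%g)) => [|s].
  by rewrite sumr_const -[(chi 1%g *+ _)%R]mulr_natr mulKf.
rewrite mem_nclosure_eqclass // => /andP[Us _]; rewrite cfker1 // -Kchi.
by move: Us; rewrite -/U -defK => /setIP[].
Qed.
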